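(* Let $A$ be a commutative ring, and let $M$ be a commutative, cancellative, torsion-free monoid. The following are equivalent: (1) The monoid algebra $A[M]$ is unit-additive. (2) $A$ is unit-additive and $M$ is positive.
   Context: All rings are commutative and unital; here $A$ is a nonzero ring. A ring $R$ is unit-additive if whenever $u,v$ are units of $R$, $u+v$ is either a unit of $R$ or a nilpotent element. Monoids are written multiplicatively as $(M,\cdot,1)$. $M$ is cancellative if $xz=yz$ implies $x=y$. An element $x\in M$ is a unit if $xy=1$ for some $y\in M$; $M$ is positive if $1$ is its only unit. An element $x\in M$ is a torsion element if $x^n=1$ for some integer $n\ge 1$; $M$ is torsion-free if $1$ is its only torsion element. $A[M]$ is the usual monoid algebra: the free $A$-module on the basis $M$ with multiplication determined by $(ax)(by)=(ab)(xy)$ for $a,b\in A$, $x,y\in M$. *)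

(* Defs.v *)
From HB Require Import structures.
From mathcomp Require Import all_boot all_algebra all_fingroup.
From mathcomp Require Import finmap.
From mathcomp.multinomials Require Import monalg.

Set Implicit Arguments.
Unset Strict Implicit.
Unset Printing Implicit Defensive.

Import GRing.Theory.

Local Open Scope ring_scope.

(* GRing.unit is not used here: it requires a unitRingType, i.e. a boolean
   unit test, which neither A nor the monoid algebra is assumed to carry. *)
Definition ring_unit (R : comNzRingType) (x : R) : Prop :=
  exists y : R, x * y = 1.

Definition nilpotent (R : comNzRingType) (x : R) : Prop :=
  exists n : nat, x ^+ n = 0.

Definition unit_additive (R : comNzRingType) : Prop :=
  forall u v : R, ring_unit u -> ring_unit v ->
    ring_unit (u + v) \/ nilpotent (u + v).

HB.mixin Record Monoid_isCommutative M of Monoid M := {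
  mulgC : forall x y : M, (x * y = y * x)%g
}.

#[short(type="comMonoidType")]
HB.structure Definition ComMonoid := { M of Monoid_isCommutative M & Monoid M }.

Bind Scope group_scope with ComMonoid.sort.

Section MonoidPredicates.

Local Open Scope group_scope.

Context (M : comMonoidType).

Definition cancellative : Prop := forall x y z : M, x * z = y * z -> x = y.

Definition monoid_unit (x : M) : Prop := exists y : M, x * y = 1.

Definition positive : Prop := forall x : M, monoid_unit x -> x = 1.

Definition torsion (x : M) : Prop := exists2 n : nat, (1 <= n)%N & x ^+ n = 1.

Definition torsion_free : Prop := forall x : M, torsion x -> x = 1.

End MonoidPredicates.

(* The A-module {malg A[M]} of finitely supported functions M -> A is free on
   M, with << a *g x >> the element a x.  Its multiplication in monalg is only
   defined for a monomType, whose axioms force M to be positive; the alias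
   below carries the convolution product over an arbitrary commutative
   monoid. *)
Definition monoid_algebra (A : comNzRingType) (M : comMonoidType) : Type :=
  {malg A[M]}.

Bind Scope ring_scope with monoid_algebra.

Section MonoidAlgebra.

Context (A : comNzRingType) (M : comMonoidType).

Local Notation AM := (monoid_algebra A M).

HB.instance Definition _ := GRing.Lmodule.on AM.

Implicit Types (f g h : AM) (x y : M) (a b : A).

Definition malg_mono a x : AM := << a *g x >>.

Definition malg_one : AM := malg_mono 1 1%g.

Definition malg_mul f g : AM :=
  \sum_(x <- msupp f) \sum_(y <- msupp g) malg_mono (f@_x * g@_y) (x * y)%g.

Lemma malg_mono0 x : malg_mono 0 x = 0.
Proof. exact: monalgU0. Qed.

Lemma malg_monoD a b x : malg_mono (a + b) x = malg_mono a x + malg_mono b x.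
Proof. exact: monalgUD. Qed.

Lemma malg_monoZ a b x : a *: malg_mono b x = malg_mono (a * b) x.
Proof. by apply/malgP=> y; rewrite mcoeffZ /malg_mono !mcoeffU mulrnAr. Qed.

Lemma malg_monoE f : f = \sum_(x <- msupp f) malg_mono f@_x x.
Proof. exact: monalgE. Qed.

Lemma malg_mulEw (d1 d2 : {fset M}) f g :
  (msupp f `<=` d1)%fset -> (msupp g `<=` d2)%fset ->
  malg_mul f g = \sum_(x <- d1) \sum_(y <- d2) malg_mono (f@_x * g@_y) (x * y)%g.
Proof.
move=> le1 le2; rewrite /malg_mul (big_fset_incl _ le1) /=.
  apply/eq_bigr=> x _; apply/big_fset_incl => // y _ /mcoeff_outdom ->.
  by rewrite mulr0 malg_mono0.
move=> x _ /mcoeff_outdom fx.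
by rewrite big1 // => y _; rewrite fx mul0r malg_mono0.
Qed.

Lemma malg_mul_mono a b x y :
  malg_mul (malg_mono a x) (malg_mono b y) = malg_mono (a * b) (x * y)%g.
Proof.
by rewrite (malg_mulEw msuppU_le msuppU_le) !big_seq_fset1 !mcoeffUU.
Qed.

Lemma malg_mulC : commutative malg_mul.
Proof.
move=> f g; rewrite /malg_mul exchange_big /=.
apply/eq_bigr=> y _; apply/eq_bigr=> x _.
by rewrite mulrC mulgC.
Qed.

Lemma malg_mulDl : left_distributive malg_mul +%R.
Proof.
move=> f g h.
rewrite [in RHS](malg_mulEw (fsubsetUl _ (msupp g)) (fsubset_refl _)).
rewrite [in RHS](malg_mulEw (fsubsetUr (msupp f) _) (fsubset_refl _)).
rewrite (malg_mulEw (msuppD_le f g) (fsubset_refl _)).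
rewrite -big_split /=; apply/eq_bigr=> x _.
rewrite -big_split /=; apply/eq_bigr=> y _.
by rewrite mcoeffD mulrDl malg_monoD.
Qed.

Lemma malg_mulDr : right_distributive malg_mul +%R.
Proof. by move=> f g h; rewrite !(malg_mulC f) malg_mulDl. Qed.

Lemma malg_mul0 : left_zero 0 malg_mul.
Proof. by move=> f; rewrite /malg_mul msupp0 big_seq_fset0. Qed.

Lemma malg_mulr0 : right_zero 0 malg_mul.
Proof. by move=> f; rewrite malg_mulC malg_mul0. Qed.

Lemma malg_mul_suml (I : Type) (r : seq I) (F : I -> AM) g :
  malg_mul (\sum_(i <- r) F i) g = \sum_(i <- r) malg_mul (F i) g.
Proof.
exact: (big_morph (malg_mul^~ g) (fun _ _ => malg_mulDl _ _ _) (malg_mul0 _)).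
Qed.

Lemma malg_mul_sumr (I : Type) (r : seq I) (F : I -> AM) f :
  malg_mul f (\sum_(i <- r) F i) = \sum_(i <- r) malg_mul f (F i).
Proof.
exact: (big_morph (malg_mul f) (fun _ _ => malg_mulDr _ _ _) (malg_mulr0 _)).
Qed.

Lemma malg_mulA : associative malg_mul.
Proof.
move=> f g h; rewrite (malg_monoE f) (malg_monoE g) (malg_monoE h).
rewrite !malg_mul_suml; apply/eq_bigr=> x _.
rewrite !(malg_mul_sumr _ _ (malg_mono f@_x x)) malg_mul_suml.
apply/eq_bigr=> y _; rewrite !malg_mul_sumr; apply/eq_bigr=> z _.
by rewrite !malg_mul_mono mulrA mulgA.
Qed.

Lemma malg_mul1 : left_id malg_one malg_mul.
Proof.
move=> f; rewrite [in LHS](malg_monoE f) malg_mul_sumr [RHS]malg_monoE.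
by apply/eq_bigr=> x _; rewrite malg_mul_mono mul1r mul1g.
Qed.

Lemma malg_one_neq0 : malg_one != 0.
Proof. by rewrite monalgU_eq0 oner_eq0. Qed.

HB.instance Definition _ := GRing.Zmodule_isComNzRing.Build AM
  malg_mulA malg_mulC malg_mul1 malg_mulDl malg_one_neq0.

Lemma malg_monoM a b x y :
  malg_mono a x * malg_mono b y = malg_mono (a * b) (x * y)%g.
Proof. exact: malg_mul_mono. Qed.

Lemma malg_scaleAl a f g : a *: (f * g) = (a *: f) * g.
Proof.
have scaleE h : a *: h = malg_mul (malg_mono a 1%g) h.
  rewrite [in LHS](malg_monoE h) [in RHS](malg_monoE h).
  rewrite scaler_sumr malg_mul_sumr; apply/eq_bigr=> x _.
  by rewrite malg_mul_mono mul1g malg_monoZ.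
by rewrite !scaleE; exact: mulrA.
Qed.

HB.instance Definition _ := GRing.Lmodule_isLalgebra.Build A AM malg_scaleAl.

HB.instance Definition _ := GRing.Lalgebra_isComAlgebra.Build A AM.

End MonoidAlgebra.

(* Main.v *)
Require Import Defs.
From HB Require Import structures.
From Stdlib Require Import Classical.
From mathcomp Require Import all_boot all_algebra all_fingroup.
From mathcomp Require Import finmap.
From mathcomp Require Import zify ring.
From mathcomp.multinomials Require Import monalg.

(** Applying the augmentation A[M] -> A to 1 - x, for x a unit of M, shows that
    1 - x is not a unit; so it is nilpotent, and the coefficient of 1 in its
    powers shows that x is torsion.

    Conversely, if M is positive then f |-> f_1 (the coefficient at the identity
    of M) is a ring morphism A[M] -> A, and everything reduces to showing that
    f - f_1 is nilpotent for f a unit with inverse g.  The finite set S made of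
    1 and the supports of f and g has a weight w : S -> nat that is additive on
    the products of two elements of S and such that w x <> w 1 for x <> 1: this
    is a generic linear form on the quotient of Q^S by the relations holding
    in M, where no x <> 1 of S vanishes since M is torsion-free.  Weighting
    each monomial x by 'X^(w x) turns f g = 1 into an identity
    p q = 'X^(2 w 1) in A[M]['X], which forces the products p_i q_j with
    i + j <> 2 w 1 to be nilpotent.  As q_(w 1) = g_1 is a unit, the p_i with
    i <> w 1 are nilpotent, and f - f_1 is their sum. *)

Set Implicit Arguments.
Unset Strict Implicit.
Unset Printing Implicit Defensive.

Import GRing.Theory Num.Theory.

Local Open Scope ring_scope.

(** * Nilpotent elements and units of a commutative ring *)

Section Nilpotent.

Context (R : comNzRingType).
Implicit Types x y : R.

Lemma nilpotent0 : nilpotent (0 : R).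
Proof. by exists 1%N; rewrite expr1. Qed.

Lemma nilpotentMl x y : nilpotent x -> nilpotent (x * y).
Proof. by case=> n xn; exists n; rewrite exprMn xn mul0r. Qed.

Lemma nilpotentMr x y : nilpotent y -> nilpotent (x * y).
Proof. by rewrite mulrC; exact: nilpotentMl. Qed.

Lemma nilpotentN x : nilpotent x -> nilpotent (- x).
Proof. by rewrite -mulN1r; exact: nilpotentMr. Qed.

Lemma nilpotentX x n : nilpotent (x ^+ n) -> nilpotent x.
Proof. by case=> m xnm; exists (n * m)%N; rewrite exprM. Qed.

Lemma nilpotentD x y : nilpotent x -> nilpotent y -> nilpotent (x + y).
Proof.
move=> [m xm] [n yn]; exists (m + n)%N; rewrite exprDn big1 // => -[i /= _] _.
have [le_ni|lt_in] := leqP n i.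
  by rewrite -(subnK le_ni) [y ^+ _]exprD yn !mulr0 mul0rn.
by rewrite -addnBA 1?ltnW // exprD xm !mul0r mul0rn.
Qed.

Lemma nilpotent_sum (I : Type) (r : seq I) (P : pred I) (F : I -> R) :
  (forall i, P i -> nilpotent (F i)) -> nilpotent (\sum_(i <- r | P i) F i).
Proof. exact: (big_ind _ nilpotent0 nilpotentD). Qed.

Lemma ring_unit_nilpotentM u x :
  ring_unit u -> nilpotent (x * u) -> nilpotent x.
Proof.
by case=> v uv /(nilpotentMl v); rewrite -mulrA uv mulr1.
Qed.

Lemma ring_unitM x y : ring_unit x -> ring_unit y -> ring_unit (x * y).
Proof. by move=> [z xz] [t yt]; exists (z * t); rewrite mulrACA xz yt mulr1. Qed.

Lemma ring_unit_1Bnilpotent x : nilpotent x -> ring_unit (1 - x).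
Proof.
case=> n xn; exists (\sum_(i < n) x ^+ i).
by rewrite -opprB mulNr -subrX1 xn sub0r opprK.
Qed.

Lemma ring_unitDnilpotent u x :
  ring_unit u -> nilpotent x -> ring_unit (u + x).
Proof.
move=> uU nx; have [v uv] := uU.
have -> : u + x = u * (1 - v * - x) by rewrite mulrBr mulrA uv !mul1r opprK mulr1.
by apply/ring_unitM => //; apply/ring_unit_1Bnilpotent/nilpotentMr/nilpotentN.
Qed.

End Nilpotent.

(** * Nilpotent products of coefficients of two polynomials *)

Section PolyNilpotent.

Context (R : comNzRingType).
Implicit Types p q : {poly R}.

(* The square of [p`_i * q`_j] is [- \sum_(i' != i) (p`_i * q`_j) * (p`_i' * q`_j')],
   and each term contains one of the two products assumed nilpotent. *)
Lemma nilpotent_coefM_step p q i j :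
  (p * q)`_(i + j) = 0 ->
  (forall i' j', (i' + j' = i + j)%N -> i' != i ->
     nilpotent (p`_i * q`_j') \/ nilpotent (p`_i' * q`_j)) ->
  nilpotent (p`_i * q`_j).
Proof.
move=> pq0 nil; apply: (@nilpotentX _ _ 2).
have lt_i : (i < (i + j).+1)%N by rewrite ltnS leq_addr.
move: pq0; rewrite coefM (bigD1 (Ordinal lt_i)) //= addKn => /eqP.
rewrite addr_eq0 => /eqP pqE; rewrite expr2 [X in X * _]pqE mulNr.
apply: nilpotentN; rewrite mulr_suml; apply: nilpotent_sum => k neq_ki.
have -> : p`_k * q`_(i + j - k) * (p`_i * q`_j)
    = (p`_i * q`_(i + j - k)) * (p`_k * q`_j).
  by ring.
have [||nil'|nil'] := nil k (i + j - k)%N; last exact: nilpotentMr.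
- by rewrite subnKC // -ltnS.
- by apply: contra neq_ki => /eqP ki; apply/eqP/val_inj.
- exact: nilpotentMl.
Qed.

(** If i' + j' = i + j with i' != i, then i' < i or j' < j, so one of the two cross products has a
    smaller index sum and induction applies. *)
Lemma nilpotent_coefM_low p q c :
  (forall n, (n < c)%N -> (p * q)`_n = 0) ->
  forall i j, (i + j < c)%N -> nilpotent (p`_i * q`_j).
Proof.
move=> pq0 i j; move def_n: (i + j)%N => n.
elim/ltn_ind: n => n IHn in i j def_n * => lt_nc.
apply: nilpotent_coefM_step => [|i' j' def_n' neq_i]; first by rewrite def_n pq0.
have [lt_i|gt_i|eq_i] := ltngtP i' i; last by rewrite eq_i eqxx in neq_i.
- by right; apply: (IHn (i' + j)%N) => //; lia.
- by left; apply: (IHn (i + j')%N) => //; lia.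
Qed.

Lemma nilpotent_coefM_high p q c :
  (forall n, (c < n)%N -> (p * q)`_n = 0) ->
  forall i j, (c < i + j)%N -> nilpotent (p`_i * q`_j).
Proof.
move=> pq0 i j; move def_m: (size p + size q - (i + j))%N => m.
elim/ltn_ind: m => m IHm in i j def_m * => lt_c.
(* Past either size the product is 0. Otherwise i + j < [size p + size q], so the truncated
   difference strictly decreases as the index sum grows. *)
have [le_pi|lt_ip] := leqP (size p) i.
  by rewrite [p`_i]nth_default // mul0r; exact: nilpotent0.
have [le_qj|lt_jq] := leqP (size q) j.
  by rewrite [q`_j]nth_default // mulr0; exact: nilpotent0.
apply: nilpotent_coefM_step => [|i' j' def_n' neq_i]; first by rewrite pq0.
have [lt_i|gt_i|eq_i] := ltngtP i' i; last by rewrite eq_i eqxx in neq_i.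
- by left; apply: (IHm (size p + size q - (i + j'))%N) => //; lia.
- by right; apply: (IHm (size p + size q - (i' + j))%N) => //; lia.
Qed.

Lemma nilpotent_coefM_Xn p q c i j :
  p * q = 'X^c -> (i + j)%N != c -> nilpotent (p`_i * q`_j).
Proof.
move=> pqE; have pq0 n : n != c -> (p * q)`_n = 0.
  by move/negPf=> neq_nc; rewrite pqE coefXn neq_nc.
case: ltngtP => // [lt_c|gt_c] _.
- by apply: (@nilpotent_coefM_low _ _ c) => // n lt_n; rewrite pq0 // ltn_eqF.
- by apply: (@nilpotent_coefM_high _ _ c) => // n lt_n; rewrite pq0 // gtn_eqF.
Qed.

End PolyNilpotent.

(** * Multiplicative maps out of A[M], and the coefficient at 1 *)

Section AlgebraMorphism.

Context (A : comNzRingType) (M : comMonoidType).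
Local Notation AM := (monoid_algebra A M).
Implicit Types f g : AM.

Lemma malg_mulE f g : f * g =
  \sum_(x <- msupp f) \sum_(y <- msupp g) malg_mono (f@_x * g@_y) (x * y)%g.
Proof. by []. Qed.

(** Three maps related only on the supports, because the weights [w] and [W] used later differ and
    are compatible only there. *)
Lemma malg_mmapM (S : comNzRingType) (phi : {rmorphism A -> S})
    (h1 h2 h : M -> S) f g :
  {in msupp f & msupp g, forall x y, h (x * y)%g = h1 x * h2 y} ->
  mmap phi h (f * g) = mmap phi h1 f * mmap phi h2 g.
Proof.
move=> hM; rewrite malg_mulE raddf_sum mulr_suml /= big_seq [RHS]big_seq.
apply: eq_bigr => x xf; rewrite raddf_sum mulr_sumr big_seq [RHS]big_seq.
apply: eq_bigr => y yg; rewrite [LHS]mmapU /= rmorphM hM //.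
by rewrite mulrACA.
Qed.

Lemma malg_mmap1 (S : comNzRingType) (phi : {rmorphism A -> S}) (h : M -> S) :
  mmap phi h (1 : AM) = h 1%g.
Proof. by rewrite [LHS]mmapU /= rmorph1 mul1r. Qed.

Lemma mmap_mcoeff1 f : mmap idfun (fun x : M => (x == 1%g)%:R) f = f@_1%g.
Proof.
rewrite {2}[f]malg_monoE raddf_sum /= mmapE; apply: eq_bigr => x _.
by rewrite mcoeffU mulr_natr.
Qed.

Lemma mcoeff1_1 : (1 : AM)@_1%g = 1.
Proof. exact: mcoeffUU. Qed.

(** Positivity makes the indicator of 1 multiplicative on [M]: a product is 1 only if both factors
    are. *)
Lemma mcoeff1M f g : positive M -> (f * g)@_1%g = f@_1%g * g@_1%g.
Proof.
move=> Mpos; rewrite -!mmap_mcoeff1; apply: malg_mmapM => x y _ _.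
rewrite -natrM mulnb; congr (_ %:R); congr nat_of_bool.
apply/eqP/andP => [xy1|[/eqP-> /eqP->]]; last by rewrite mul1g.
by split; apply/eqP/Mpos; [exists y | exists x; rewrite mulgC].
Qed.

End AlgebraMorphism.

(** * Subspaces, generic vectors and denominators *)

Section LinearAlgebra.

(** Enlarge [W] by a vector of [P] outside it while one exists; the rank grows each time and is at
    most n. [P] need not be decidable, hence the classical case split. *)
Lemma subspace_mx (F : fieldType) n (P : 'rV[F]_n -> Prop) :
  P 0 -> (forall u v, P u -> P v -> P (u + v)) ->
  (forall c u, P u -> P (c *: u)) ->
  exists W : 'M[F]_n, forall u, P u <-> (u <= W)%MS.
Proof.
move=> P0 PD PZ.
suff grow k (W : 'M[F]_n) : (n <= \rank W + k)%N ->
    (forall u, (u <= W)%MS -> P u) ->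
    exists W' : 'M[F]_n, forall u, P u <-> (u <= W')%MS.
  apply: (grow n (0 : 'M[F]_n)) => [|u]; first by rewrite mxrank0.
  by move/submx0null ->.
elim: k W => [|k IHk] W rkW WP.
  exists W => u; split=> [_|/WP//]; apply/submx_full.
  by rewrite /row_full eqn_leq rank_leq_col; move: rkW; rewrite addn0.
have [[u [Pu uW]]|noP] := classic (exists u, P u /\ ~ (u <= W)%MS); last first.
  exists W => u; split=> [Pu|/WP//].
  by apply: NNPP => uW; apply: noP; exists u.
apply: (IHk (u + W)%MS) => [|v].
  suff : (W < u + W)%MS by move/rank_ltmx; lia.
  by rewrite ltmxE addsmxSr; apply/negP => /(submx_trans (addsmxSl _ _)).
case/sub_addsmxP=> -[D E] /= ->; apply: PD; last exact/WP/submxMl.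
by rewrite [D]mx11_scalar mul_scalar_mx; apply: PZ.
Qed.

(* Rows are read as polynomials: v lists the powers of a common non-root of
   the nonzero ones. *)
Lemma generic_vector (F : numFieldType) m n (C : 'M[F]_(m, n)) :
  exists v : 'cV[F]_n, forall i, row i C != 0 -> (C *m v) i 0 != 0.
Proof.
pose p := \prod_(i | row i C != 0) rVpoly (row i C).
have [t pt] : exists t : F, p.[t] != 0.
  have p0 : p != 0.
    apply/prodf_neq0 => i; apply: contra => /eqP Ci0.
    by apply/eqP; rewrite -[row i C]rVpolyK Ci0 linear0.
  pose s := [seq i%:R : F | i <- iota 0 (size p)].
  have Us : uniq s by rewrite map_inj_uniq ?iota_uniq // => i j /eqP; rewrite eqr_nat => /eqP.
  have /allPn[t _ pt] : ~~ all (root p) s.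
    apply/negP => ps; have := max_poly_roots p0 ps Us.
    by rewrite size_map size_iota ltnn.
  by exists t.
exists (\col_j t ^+ j) => i Ci; move: pt.
rewrite horner_prod => /prodf_neq0 /(_ i Ci).
rewrite horner_poly mxE; congr (_ != 0); apply: eq_bigr => j _.
by rewrite valK !mxE.
Qed.

Lemma clear_denominators n (v : 'I_n -> rat) :
  exists (N : nat) (a : 'I_n -> int),
    (0 < N)%N /\ forall i, v i * N%:R = (a i)%:~R.
Proof.
exists (\prod_i `|denq (v i)|)%N.
exists (fun i => numq (v i) * (\prod_(j | j != i) `|denq (v j)|)%N%:Z).
split=> [|i]; first by apply: prodn_gt0 => i; rewrite absz_gt0 denq_neq0.
rewrite (bigD1 i) //= natrM intrM mulrA; congr (_ * _).
by rewrite [X in _ * X]pmulrn abszE ger0_norm ?denq_ge0 // -numqE.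
Qed.

End LinearAlgebra.

(** * Weights on a finite subset of the monoid *)

HB.instance Definition _ (M : comMonoidType) :=
  Monoid.isComLaw.Build M 1%g (@mulg M) (@mulgA M) (@mulgC M) (@mul1g M).

Section Weights.

Context (M : comMonoidType).
Hypotheses (hcancel : cancellative M) (htors : torsion_free M).

Local Notation monom x a := (\prod_i x i ^+ a i)%g.

Lemma monomD n (x : 'I_n -> M) (a b : 'I_n -> nat) :
  monom x (fun i => a i + b i)%N = (monom x a * monom x b)%g.
Proof. by rewrite -big_split; apply: eq_bigr => i _; rewrite expgnDr. Qed.

Lemma monomMn n (x : 'I_n -> M) (a : 'I_n -> nat) k :
  monom x (fun i => k * a i)%N = (monom x a ^+ k)%g.
Proof.
elim: k => [|k IHk]; first by rewrite big1.
by rewrite expgS -IHk -monomD; apply: eq_bigr => i _; rewrite mulSn.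
Qed.

Lemma monom_delta n (x : 'I_n -> M) i k :
  monom x (fun j => k * (j == i))%N = (x i ^+ k)%g.
Proof.
rewrite (bigD1 i) //= eqxx muln1 big1 ?mulg1 // => j /negPf->.
by rewrite muln0.
Qed.

Lemma exists_additive_weight n (x : 'I_n -> M) :
  exists phi : 'I_n -> int,
    (forall a b : 'I_n -> nat, monom x a = monom x b ->
       \sum_i phi i * (a i)%:Z = \sum_i phi i * (b i)%:Z) /\
    (forall i, x i != 1%g -> phi i != 0).
Proof.
(* P is the Q-span of the differences a - b of exponents of relations. *)
pose P (q : 'rV[rat]_n) := exists (N : nat) (a b : 'I_n -> nat),
  [/\ (0 < N)%N, monom x a = monom x b &
      forall i, q 0 i * N%:R = (a i)%:R - (b i)%:R].
have PD q r : P q -> P r -> P (q + r).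
  move=> [N [a [b [N0 xab qE]]]] [K [c [d [K0 xcd rE]]]].
  exists (N * K)%N, (fun i => K * a i + N * c i)%N, (fun i => K * b i + N * d i)%N.
  split=> [||i]; first by rewrite muln_gt0 N0.
    by rewrite !monomD !monomMn xab xcd.
  rewrite mxE !natrD !natrM opprD addrACA -!mulrBr -qE -rE; ring.
have PN q : P q -> P (- q).
  move=> [N [a [b [N0 xab qE]]]]; exists N, b, a; split=> // i.
  by rewrite mxE mulNr qE opprB.
have PZn (k d : nat) q : (0 < d)%N -> P q -> P ((k%:R / d%:R) *: q).
  move=> d0 [N [a [b [N0 xab qE]]]].
  exists (d * N)%N, (fun i => k * a i)%N, (fun i => k * b i)%N.
  split=> [||i]; first by rewrite muln_gt0 d0.
    by rewrite !monomMn xab.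
  rewrite mxE !natrM -mulrBr -qE; field.
  by rewrite pnatr_eq0 -lt0n.
have PZ c q : P q -> P (c *: q).
  move=> Pq; rewrite -[c]divq_num_den -[denq c]gez0_abs ?denq_ge0 // -pmulrn.
  have d0 : (0 < `|denq c|)%N by rewrite absz_gt0 denq_neq0.
  case: (numq c) => k; first exact: PZn.
  by rewrite NegzE intrN mulNr scaleNr; apply/PN/PZn.
have P0 : P 0.
  exists 1%N, (fun _ => 0%N), (fun _ => 0%N); split=> // i.
  by rewrite mxE mul0r subrr.
have [W PW] := subspace_mx P0 PD PZ.
(* Row i of [cokermx W] is the class of the i-th basis vector modulo [P], so the form given by [v]
   kills the relations but no nonzero class of a basis vector. *)
have [v vW] := generic_vector (cokermx W).
have [N [phi [N0 phiE]]] := clear_denominators (fun i => (cokermx W *m v) i 0).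
exists phi; split=> [a b xab|i].
  pose q : 'rV[rat]_n := \row_i ((a i)%:R - (b i)%:R).
  have /PW : P q by exists 1%N, a, b; split=> // i; rewrite mxE mulr1.
  rewrite submxE => /eqP qW.
  have : (q *m (cokermx W *m v)) 0 0 * N%:R = 0 by rewrite mulmxA qW mul0mx mxE mul0r.
  rewrite mxE mulr_suml.
  under eq_bigr => i _.
    rewrite -mulrA phiE mxE mulrC [(a i)%:R]pmulrn [(b i)%:R]pmulrn -intrB -intrM.
    over.
  rewrite -(rmorph_sum (intmul 1)) /= => /eqP; rewrite intr_eq0.
  under eq_bigr => i _ do rewrite mulrBr.
  by rewrite sumrB subr_eq0 => /eqP.
apply: contra => /eqP phi0; apply/eqP/htors.
have: row i (cokermx W) == 0.
  apply: contraT => /vW; have := phiE i; rewrite phi0 => /eqP.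
  by rewrite mulf_eq0 pnatr_eq0 -[(N == 0)%N]negbK -lt0n N0 orbF => ->.
(* Here [K] times the i-th basis vector is a - b, so x_i^K times [monom x b] is [monom x a], which
   equals [monom x b]; cancelling gives torsion. *)
rewrite rowE -submxE => /PW[K [a [b [K0 xab deltaE]]]].
exists K => //; apply: (hcancel (z := monom x b)); rewrite mul1g -[RHS]xab.
rewrite -monom_delta -monomD; apply: eq_bigr => j _; congr (_ ^+ _)%g.
apply/eqP; rewrite -(eqr_nat rat) natrD natrM; apply/eqP.
by have /(congr1 (+%R^~ (b j)%:R)) := deltaE j; rewrite mxE eqxx /= subrK mulrC.
Qed.

(** A form shifted by a constant is no longer additive, but products of exactly two elements all
    carry the same double shift; hence a separate [W] for products. *)
Lemma exists_weight (S : seq M) : 1%g \in S ->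
  exists w W : M -> nat,
    {in S &, forall x y, W (x * y)%g = (w x + w y)%N} /\
    {in S, forall x, x != 1%g -> w x != w 1%g}.
Proof.
move=> S1; pose x := tnth (in_tuple S).
have [phi [phiD phi0]] := exists_additive_weight x.
(* The shift by B makes the weights nonnegative. *)
pose B : int := \sum_i `|phi i|.
(* [S] may have repetitions: [pick] chooses one index of y. The value 0 outside [S] is arbitrary. *)
pose w y := if [pick i | x i == y] is Some i then `|(phi i + B)%R|%N else 0%N.
(* [ps z] lists the factorisations of z over [S], and [W] reads off the first; by [w_rel] any other
   gives the same weight. *)
pose ps z := [seq p <- [seq (y, t) | y <- S, t <- S] | (p.1 * p.2 == z)%g].
pose W z := let p := head (1%g, 1%g) (ps z) in (w p.1 + w p.2)%N.
have wE y : y \in S -> exists2 i, x i = y & (w y)%:Z = phi i + B.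
  move=> /seq_tnthP[j yE]; rewrite /w; case: pickP => [i /eqP xi|/(_ j)]; last first.
    by rewrite /x -yE eqxx.
  exists i => //; rewrite gez0_abs // /B (bigD1 i) //= addrA addr_ge0 ?sumr_ge0 //.
  by rewrite -lerBlDl sub0r -normrN ler_norm.
pose d i j := fun k : 'I_(size S) => (1 * (k == i) + 1 * (k == j))%N.
have dE1 i : \sum_k phi k * (1 * (k == i))%:Z = phi i.
  by rewrite (bigD1 i) //= eqxx mulr1 big1 ?addr0 // => k /negPf->; rewrite mulr0.
have dE i j : \sum_k phi k * (d i j k)%:Z = phi i + phi j.
  by rewrite -[phi i]dE1 -[phi j]dE1 -big_split; apply: eq_bigr => k _; rewrite PoszD mulrDr.
have x_d i j : monom x (d i j) = (x i * x j)%g.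
  rewrite [LHS]monomD -[x i]expg1 -[x j]expg1.
  by congr (_ * _)%g; exact: monom_delta.
have w_rel y z t u : y \in S -> z \in S -> t \in S -> u \in S ->
    (y * z = t * u)%g -> (w y + w z = w t + w u)%N.
  move=> /wE[i xi wi] /wE[j xj wj] /wE[k xk wk] /wE[l xl wl] yztu.
  have /phiD : monom x (d i j) = monom x (d k l).
    by rewrite !x_d xi xj xk xl.
  by rewrite !dE; lia.
exists w, W; split=> [y z yS zS|y yS y1].
  have : (y, z) \in ps (y * z)%g.
    by rewrite mem_filter eqxx; apply/allpairsP; exists (y, z).
  rewrite /W; case Eps: (ps _) => [|p s] //= _.
  have : p \in ps (y * z)%g by rewrite Eps mem_head.
  rewrite mem_filter => /andP[/eqP pE /allpairsP[[t u] /= [tS uS def_p]]].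
  by rewrite def_p /= in pE *; apply: w_rel.
have [i xi wi] := wE _ yS; have [j xj wj] := wE _ S1.
(* Comparing x_j = 1 with the empty monomial shows that [w 1] is exactly [B]. *)
have phij : phi j = 0.
  have /phiD : monom x (fun k : 'I__ => 1 * (k == j))%N = monom x (fun=> 0%N).
    by rewrite monom_delta xj expg1n big1.
  by rewrite dE1 => ->; rewrite big1 // => k _; rewrite mulr0.
have : phi i != 0 by apply: phi0; rewrite xi.
apply: contra => /eqP; lia.
Qed.

End Weights.

(** * Nilpotent elements and units of the monoid algebra *)

Section Units.

Context (A : comNzRingType) (M : comMonoidType).
Local Notation AM := (monoid_algebra A M).
Implicit Types f g : AM.

Lemma malg_monoXn x n : malg_mono 1 x ^+ n = malg_mono 1 (x ^+ n)%g :> AM.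
Proof.
elim: n => [|n IHn]; first by rewrite expr0.
by rewrite exprS expgS IHn malg_monoM mulr1.
Qed.

Lemma malg_mono1E a : malg_mono a 1%g = a%:A :> AM.
Proof. by rewrite malg_monoZ mulr1. Qed.

Lemma augmentationM f g : mmap idfun (fun=> 1 : A) (f * g) =
  mmap idfun (fun=> 1) f * mmap idfun (fun=> 1) g.
Proof. by apply: malg_mmapM => x y _ _; rewrite mulr1. Qed.

(** If no positive power of x is 1, only the first term of the binomial expansion of (1 - x)^n
    contributes at 1, and its coefficient there is 1. *)
Lemma nilpotent_1Bmono_torsion x :
  nilpotent (1 - malg_mono 1 x : AM) -> torsion x.
Proof.
move=> [n xn0]; apply: NNPP => xNtor.
have xN1 k : (0 < k)%N -> (x ^+ k)%g != 1%g.
  by move=> k0; apply/eqP => xk; apply: xNtor; exists k.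
have /eqP := congr1 (mcoeff 1%g) xn0; rewrite mcoeff0.
rewrite exprBn big_ord_recl /= subn0 expr0 !expr1n !mulr1 mcoeffD mcoeffMn.
rewrite bin0 mulr1n mcoeff1_1 raddf_sum /= big1 ?addr0 ?oner_eq0 // => i _.
rewrite expr1n mulr1 malg_monoXn mcoeffMn -signr_odd mulr_sign.
have xi : (malg_mono 1 (x ^+ (bump 0 i))%g : AM)@_1%g = 0.
  by rewrite mcoeffU (negPf (xN1 _ _)).
by case: ifP; rewrite ?mcoeffN xi ?oppr0 mul0rn.
Qed.

Lemma unit_sub_mcoeff1_nilpotent f :
  cancellative M -> torsion_free M -> positive M -> ring_unit f ->
  nilpotent (f - (f@_1%g)%:A).
Proof.
move=> Mcancel Mtors Mpos [g fg1].
have fg1_1 : f@_1%g * g@_1%g = 1 by rewrite -mcoeff1M // fg1 mcoeff1_1.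
pose S := 1%g :: (msupp f ++ msupp g : seq M).
have [||//|w [W [Ww wN1]]] := @exists_weight M _ _ S; rewrite ?mem_head //.
have fS : {subset msupp f <= S} by move=> x xf; rewrite inE mem_cat xf orbT.
have gS : {subset msupp g <= S} by move=> x xg; rewrite inE mem_cat xg !orbT.
pose h (e : M -> nat) x : {poly AM} := malg_mono 1 x *: 'X^(e x).
pose phi : {rmorphism A -> {poly AM}} := polyC \o in_alg AM.
pose p (u : AM) := mmap phi (h w) u.
have pqE : p f * p g = 'X^(w 1 + w 1)%g.
  have <- : mmap phi (h W) (f * g) = p f * p g.
    apply: malg_mmapM => x y /fS xS /gS yS.
    by rewrite /h Ww // -scalerAl -scalerAr scalerA malg_monoM mulr1 exprD.
  rewrite fg1 malg_mmap1 /h -[X in W X]mul1g Ww ?mem_head //; exact: scale1r.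
have coef_p u i z : ((p u)`_i)@_z = u@_z *+ (w z == i).
  rewrite [in RHS](malg_monoE u) /p mmapE coef_sum !raddf_sum -sumrMnl.
  apply: eq_bigr => x _ /=; rewrite coefCM coefZ coefXn eq_sym mulr_natr mulrnAr.
  rewrite mulr_algl malg_monoZ mulr1 mcoeffMn !mcoeffU.
  by case: eqP => [->|_]; rewrite ?mulr0n ?mul0rn.
(* In [S] only 1 has weight [w 1], so this component is a scalar. *)
have coef_w1 u : {subset msupp u <= S} -> (p u)`_(w 1%g) = (u@_1%g)%:A.
  move=> uS; apply/malgP => z; rewrite coef_p -malg_mono1E mcoeffU.
  have [->|z1] := eqVneq 1%g z; first by rewrite eqxx.
  have [zu|/mcoeff_outdom->] := boolP (z \in msupp u); last by rewrite mul0rn.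
  by rewrite (negPf (wN1 _ (uS _ zu) _)) // eq_sym.
have nil_p i : i != w 1%g -> nilpotent (p f)`_i.
  move=> iN; apply: (@ring_unit_nilpotentM _ (p g)`_(w 1%g)).
    rewrite coef_w1 //; exists (f@_1%g)%:A.
    by rewrite mulr_algl scalerA mulrC fg1_1 scale1r.
  by apply: (nilpotent_coefM_Xn pqE); rewrite eqn_add2r.
(* Setting the variable to 1 forgets the weights. *)
have pf1 : (p f).[1] = f.
  rewrite [RHS]malg_monoE /p mmapE horner_sum; apply: eq_bigr => x _ /=.
  by rewrite hornerM hornerZ hornerXn expr1n hornerC mulr1 mulr_algl malg_monoZ mulr1.
(* The bound is raised above [w 1] so that the term of that index can be split off. *)
pose n := maxn (size (p f)) (w 1%g).+1.
have w1n : (w 1%g < n)%N by rewrite leq_max leqnn orbT.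
rewrite -[X in X - _]pf1 -coef_w1 // (@horner_coef_wide _ n) ?leq_maxl //.
rewrite (bigD1 (Ordinal w1n)) //= expr1n mulr1.
rewrite [X in nilpotent X]addrC addKr.
by apply: nilpotent_sum => i iN; rewrite expr1n mulr1; apply: nil_p.
Qed.

End Units.

(** * Transfer between [A] and the monoid algebra *)

Theorem proposition3p4 (A : comNzRingType) (M : comMonoidType)
  (hcancel : cancellative M) (htors : torsion_free M) :
  unit_additive (monoid_algebra A M) <-> unit_additive A /\ positive M.
Proof.
split=> [AMua|[Aua Mpos]].
  split=> [u v [u' uu'] [v' vv']|x [y xy]].
    (* The augmentation retracts A[M] onto the scalars, so it carries the unit or nilpotent
       alternative down to [A]. *)
    pose eps := mmap idfun (fun=> 1 : A) : monoid_algebra A M -> A.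
    have epsC a : eps a%:A = a by rewrite -malg_mono1E [LHS]mmapU mulr1.
    have eps1 : eps 1 = 1 by exact: malg_mmap1.
    have algU (a b : A) : a * b = 1 -> ring_unit (a%:A : monoid_algebra A M).
      by move=> ab; exists b%:A; rewrite mulr_algl scalerA ab scale1r.
    rewrite -[u + v]epsC scalerDl.
    have [[z uvz]|[n uvn]] := AMua _ _ (algU _ _ uu') (algU _ _ vv').
      by left; exists (eps z); rewrite -augmentationM uvz.
    right; exists n.
    have epsX w : eps (w ^+ n) = eps w ^+ n.
      by elim: n {uvn} => // k IHk; rewrite !exprS -IHk; exact: augmentationM.
    by rewrite -epsX uvn /eps raddf0.
  apply: htors; apply: (nilpotent_1Bmono_torsion (A := A)) => //.
  (* As x is a unit, 1 - x is a sum of two units; the augmentation kills it, so it is not a unit. *)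
  have [||[z xz]|//] := AMua 1 (- malg_mono 1 x).
  - by exists 1; rewrite mulr1.
  - by exists (- malg_mono 1 y); rewrite mulrNN malg_monoM xy mulr1.
  have /eqP := congr1 (mmap idfun (fun=> 1 : A)) xz.
  by rewrite augmentationM raddfB /= malg_mmap1 mmapU mulr1 subrr mul0r eq_sym oner_eq0.
move=> u v uU vU.
have unit1 (f : monoid_algebra A M) : ring_unit f -> ring_unit (f@_1%g).
  by case=> g fg; exists (g@_1%g); rewrite -mcoeff1M // fg mcoeff1_1.
have nil := nilpotentD (unit_sub_mcoeff1_nilpotent hcancel htors Mpos uU)
                       (unit_sub_mcoeff1_nilpotent hcancel htors Mpos vU).
(* A scalar plus a nilpotent inherits the alternative that holds for the scalar. *)
have -> : u + v = (u@_1%g + v@_1%g)%:A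
    + (u - (u@_1%g)%:A + (v - (v@_1%g)%:A)).
  by rewrite scalerDl [X in _ = _ + X]addrACA -opprD [RHS]addrC subrK.
have [[a uva]|[n uvn]] := Aua _ _ (unit1 _ uU) (unit1 _ vU).
  left; apply: ring_unitDnilpotent => //; exists a%:A.
  by rewrite mulr_algl scalerA uva scale1r.
right; apply: nilpotentD => //; exists n.
by rewrite exprZn expr1n uvn scale0r.
Qed.
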